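(* Let $n\ge 2$ and let $M=(m_{kl})\in\mathbb{R}^{n\times n}$ be a real correlation matrix satisfying $|m_{kl}|<1$ for all $k\ne l$. For each inverse eigenvector $\alpha\in\mathcal{I}(M)$ define $$c(\alpha)=\frac{1}{\det\bigl(I_n+\mathrm{D}(\alpha)M\mathrm{D}(\alpha)\bigr)}.$$ Then $c(\alpha)>0$ for every $\alpha\in\mathcal{I}(M)$, $$\sum_{\alpha\in\mathcal{I}(M)}c(\alpha)=1,\qquad\text{and}\qquad \sum_{\alpha\in\mathcal{I}(M)}c(\alpha)\,\alpha\otimes\alpha=I_n.$$ Equivalently, the measure $\mu_M=\sum_{\alpha\in\mathcal{I}(M)}c(\alpha)\,\delta_\alpha$ is a centered discrete isotropic probability measure on $\mathbb{R}^n$.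
   Context: A real correlation matrix is a real symmetric positive semidefinite matrix all of whose diagonal entries equal $1$. For an $n\times n$ matrix $M$, the set of inverse eigenvectors is $\mathcal{I}(M)=\{\alpha\in\mathbb{C}^n:\ \alpha_k(M\alpha)_k=1\text{ for every }k\in\{1,\dots,n\}\}$; for a real symmetric positive semidefinite matrix $M$ it is a finite subset of $\mathbb{R}^n$. $\mathrm{D}(x)$ denotes the diagonal matrix with diagonal $x$, $I_n$ the identity matrix, $x\otimes y=xy^\top$, and $\delta_\alpha$ the Dirac measure at $\alpha$. A measure $\mu$ on $\mathbb{R}^n$ is centered if $\int x\,d\mu(x)=0$ and isotropic if $\int xx^\top d\mu(x)=I_n$. *)

(* Defs.v *)
From HB Require Import structures.
From mathcomp Require Import all_boot all_order all_algebra complex.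
From mathcomp Require Import all_classical all_reals all_analysis.
Set Implicit Arguments.
Unset Strict Implicit.
Unset Printing Implicit Defensive.
Import Order.TTheory GRing.Theory Num.Theory.
Import numFieldNormedType.Exports.
Local Open Scope classical_set_scope.
Local Open Scope ring_scope.
Local Open Scope complex_scope.

Definition correlation_mx (R : realType) (n : nat) (M : 'M[R]_n) : Prop :=
  [/\ M^T = M,
      forall x : 'cV[R]_n, 0 <= (x^T *m M *m x) 0 0 &
      forall k, M k k = 1].

Definition inv_eigenvectors (R : realType) (n : nat) (M : 'M[R[i]]_n) :
  set 'cV[R[i]]_n := [set a : 'cV[R[i]]_n | forall k, a k 0 * (M *m a) k 0 = 1].

(* Entrywise embedding of real matrices and vectors into complex ones. *)
Definition complex_mx (R : realType) (m n : nat) (A : 'M[R]_(m, n)) :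
  'M[R[i]]_(m, n) := map_mx (real_complex R) A.

(* [diag_mx] expects a row vector, hence the transpose. *)
Definition D (K : fieldType) (n : nat) (a : 'cV[K]_n) : 'M[K]_n :=
  diag_mx a^T.

Definition tens (K : fieldType) (n : nat) (x y : 'cV[K]_n) : 'M[K]_n :=
  x *m y^T.

(* The field is left general because the weight is used both for complex
   vectors and, in the definition of the measure, for real ones. *)
Definition weight (K : fieldType) (n : nat) (M : 'M[K]_n) (a : 'cV[K]_n) : K :=
  (\det (1%:M + D a *m M *m D a))^-1.

(* R^n with its Borel sigma-algebra (topology of entrywise convergence). *)
Definition borel_cV (R : realType) (n : nat) :=
  g_sigma_algebraType (@open 'cV[R]_n).
HB.instance Definition _ (R : realType) (n : nat) :=
  Measurable.on (borel_cV R n).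

(* Integrability is required explicitly, since the Lebesgue integral is a total
   operation; the vector and matrix integrals are taken entrywise. *)
Definition centered (R : realType) (n : nat)
    (mu : {measure set (borel_cV R n) -> \bar R}) : Prop :=
  forall k : 'I_n,
    mu.-integrable setT (fun x : borel_cV R n => ((x : 'cV[R]_n) k 0)%:E) /\
    (\int[mu]_(x in setT) (((x : 'cV[R]_n) k 0)%:E) = 0)%E.

Definition isotropic (R : realType) (n : nat)
    (mu : {measure set (borel_cV R n) -> \bar R}) : Prop :=
  forall k l : 'I_n,
    mu.-integrable setT
      (fun x : borel_cV R n => (tens (x : 'cV[R]_n) (x : 'cV[R]_n) k l)%:E) /\
    (\int[mu]_(x in setT) ((tens (x : 'cV[R]_n) (x : 'cV[R]_n) k l)%:E)
      = ((1%:M : 'M[R]_n) k l)%:E)%E.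

(* The set function A |-> sum of c(a) delta_a(A), over the real points a of the
   set of inverse eigenvectors. *)
Definition inv_eig_measure (R : realType) (n : nat) (M : 'M[R]_n)
    (A : set (borel_cV R n)) : \bar R :=
  (\sum_(a \in [set a : borel_cV R n |
                 inv_eigenvectors (complex_mx M) (complex_mx (a : 'cV[R]_n))])
     (weight M (a : 'cV[R]_n))%:E * \d_a A)%E.

(* Main.v *)
Require Import Defs.
From HB Require Import structures.
From mathcomp Require Import all_boot all_order all_algebra all_fingroup complex.
From mathcomp Require Import all_classical all_reals all_analysis.
From mathcomp Require Import measurable_realfun ring lra.
Import Order.TTheory GRing.Theory Num.Theory.
Import numFieldNormedType.Exports.
Local Open Scope classical_set_scope.
Local Open Scope ring_scope.
Local Open Scope complex_scope.

Set Implicit Arguments.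
Unset Strict Implicit.
Unset Printing Implicit Defensive.


(** Why the theorem holds.  Write [c(x)] for the weight of an inverse
    eigenvector [x], [x_S] for the product of the coordinates of [x] with index
    in a set [S], and [a_S] for the principal minor of [M] on [S].

    The heart is an algebraic duality.  If [x] and [y] are inverse
    eigenvectors, then [(I + D(x) D(y) M) (x - y) = 0], because the [k]-th
    entry is [x_k (1 - y_k (My)_k) - y_k (1 - x_k (Mx)_k)].  Hence
    [det (I + D(x) D(y) M)] vanishes for [x <> y], while for [x = y] it equals
    [1 / c(x)].  Expanding this determinant gives [sum_S a_S x_S y_S]
    ([sum_pminor_sqfree]).  If there are exactly [2^n] inverse eigenvectors,
    this says that two square matrices, with rows and columns indexed by
    inverse eigenvectors and by subsets of the index set, are inverse to each
    other on one side.  They are then inverse on the other side as well, that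
    is [a_S sum_x c(x) x_S x_T = delta_(S,T)]
    ([weighted_sqfree_orthogonality]).  As [a_S = 1] when [S] has at most one
    element, the cases where [S] and [T] are empty or singletons are exactly
    the total mass, the centering and the isotropy.

    For a positive definite [M] the count [2^n] is attained: each open orthant
    contains one and only one inverse eigenvector.  It is the maximizer of the
    product of the coordinates on an ellipsoid ([inv_eig_exists]), and it is
    unique by monotonicity of [M] and of [x |-> - 1 / x]
    ([inv_eig_orthant_unique]).

    A singular [M] may have fewer inverse eigenvectors, and is approached by
    [M_t = M + t (I - M)] as [t] tends to [0].  In an orthant where [M] has an
    inverse eigenvector, those of [M_t] converge to it
    ([inv_eig_deform_stable]).  In the other orthants they escape to infinity
    ([inv_eig_deform_escape]), and there lies the role of [|m_kl| < 1].  The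
    duality for [S = T = {i, j}] bounds [c x_i^2 x_j^2] by
    [1 / (1 - m_ij^2)], uniformly in [t].  The relation
    [x_i^2 = 1 - sum_(j <> i) m_ij x_i x_j] turns this into a bound on the
    fourth moments ([coercive_weight_sqnorm_le]), so that the escaping points
    carry neither mass nor second moments away ([deformed_escape_cvg0]).

    Complex inverse eigenvectors of a real positive semidefinite matrix are
    real, since the imaginary part [y] satisfies [y^T M y <= 0]
    ([inv_eig_real]).  All sums and integrals of the theorem therefore reduce
    to finite sums over the orthants that contain an inverse eigenvector. *)

(** * Determinants as combinations of squarefree monomials *)
Section SquarefreeExpansion.
Variables (K : fieldType) (n : nat).
Implicit Types (M : 'M[K]_n) (x z : 'cV[K]_n) (S T : {set 'I_n}).

(** Rows outside [S] are rows of the identity: this is the principal minor on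
    [S], without renumbering its elements. *)
Definition pminor M S : K :=
  \det (\matrix_(i, j) (if i \in S then M i j else (i == j)%:R)).

Definition sqfree x S : K := \prod_(i in S) x i 0.

Definition hadamard x z : 'cV[K]_n := \col_i (x i 0 * z i 0).

Lemma D_mulE m z (A : 'M[K]_(n, m)) i j : (D z *m A) i j = z i 0 * A i j.
Proof. by rewrite /D mul_diag_mx !mxE. Qed.

Lemma mul_DE m z (A : 'M[K]_(m, n)) i j : (A *m D z) i j = A i j * z j 0.
Proof. by rewrite /D mul_mx_diag !mxE. Qed.

Lemma sqfree_hadamard x z S : sqfree (hadamard x z) S = sqfree x S * sqfree z S.
Proof.
by rewrite /sqfree -big_split; apply: eq_bigr => i _; rewrite mxE.
Qed.

(** In the Leibniz formula each factor is a sum of an entry of [D z *m M] and an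
    entry of the identity; [S] is the set of rows where the former is chosen. *)
Lemma det_addD_expand M z :
  \det (1%:M + D z *m M) = \sum_(S : {set _}) pminor M S * sqfree z S.
Proof.
transitivity (\sum_(s : 'S_n) \sum_(S : {set _}) (-1) ^+ s *
    ((\prod_i (if i \in S then M i (s i) else (i == s i)%:R)) * sqfree z S)).
  apply: eq_bigr => s _; rewrite -mulr_sumr; congr (_ * _).
  transitivity (\prod_i (z i 0 * M i (s i) + (i == s i)%:R)).
    by apply: eq_bigr => i _; rewrite mxE D_mulE mxE addrC.
  rewrite bigA_distr; apply: eq_bigr => S _.
  rewrite [sqfree _ _]big_mkcond/= -big_split/=; apply: eq_bigr => i _.
  by case: ifP => _; rewrite ?mulr1// mulrC.
rewrite exchange_big/=; apply: eq_bigr => S _.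
rewrite /pminor /determinant mulr_suml; apply: eq_bigr => s _.
by rewrite mulrA; congr (_ * _ * _); apply: eq_bigr => i _; rewrite !mxE.
Qed.

Lemma sqfree0 x : sqfree x finset.set0 = 1.
Proof. by rewrite /sqfree big_set0. Qed.

Lemma sqfree1 x i : sqfree x [set i]%SET = x i 0.
Proof. by rewrite /sqfree big_set1. Qed.

Lemma sqfree2 x i j : i != j -> sqfree x [set i; j]%SET = x i 0 * x j 0.
Proof. by move=> ij; rewrite /sqfree big_setU1 ?inE// big_set1. Qed.

Lemma pminor0 M : pminor M finset.set0 = 1.
Proof.
rewrite /pminor -[RHS](det1 K n); congr (\det _); apply/matrixP => i j.
by rewrite !mxE finset.in_set0.
Qed.

(** Only the permutations supported in [S] contribute to the minor on [S]. *)
Lemma pminor_perm0 M S (s : 'S_n) k : k \notin S -> s k != k ->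
  \prod_i (\matrix_(i, j) (if i \in S then M i j else (i == j)%:R) : 'M[K]_n) i (s i) = 0.
Proof.
move=> kS sk; rewrite (bigD1 k)//= !mxE (negbTE kS) eq_sym (negbTE sk).
by rewrite mul0r.
Qed.

Lemma pminor1 M k : pminor M [set k]%SET = M k k.
Proof.
rewrite /pminor /determinant (bigD1 (1%g : 'S_n))//= [X in _ + X]big1 ?addr0.
  rewrite odd_perm1 expr0 mul1r (bigD1 k)//= big1 ?mulr1.
    by rewrite perm1 mxE inE eqxx.
  by move=> i ik; rewrite !mxE perm1 inE (negbTE ik) eqxx.
move=> s s1; have /existsP[j /andP[jk sj]] : [exists j, (j != k) && (s j != j)].
  apply: contraNT s1 => /existsPn H; apply/eqP/permP => i.
  have H' j : j != k -> s j = j by move=> jk; apply/eqP; move: (H j); rewrite jk negbK.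
  rewrite perm1; have [->|/H'//] := eqVneq i k.
  apply/eqP; apply/negPn/negP => skk.
  by have /perm_inj/eqP := H' _ skk; rewrite (negbTE skk).
by rewrite (@pminor_perm0 M _ s j) ?mulr0// inE.
Qed.

Lemma pminor2 M i j : i != j ->
  pminor M [set i; j]%SET = M i i * M j j - M i j * M j i.
Proof.
move=> ij; rewrite /pminor /determinant (bigD1 (1%g : 'S_n))//=.
have tn1 : tperm i j != 1%g.
  by apply/eqP => /permP/(_ i); rewrite tpermL perm1 => /eqP; rewrite eq_sym (negbTE ij).
rewrite (bigD1 (tperm i j))//= [X in _ + (_ + X)]big1 ?addr0; last first.
  move=> s /andP[s1 st].
  have /existsP[k /andP[kS sk]] : [exists k, (k \notin [set i; j]%SET) && (s k != k)].
    apply: contraT => /existsPn H.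
    have H' k : k \notin [set i; j]%SET -> s k = k.
      by move=> jk; apply/eqP; move: (H k); rewrite jk negbK.
    have sij k : k \in [set i; j]%SET -> s k \in [set i; j]%SET.
      by move=> kS; apply/negPn/negP => /[dup] sk /H'/perm_inj skk; rewrite skk kS in sk.
    have := sij i; have := sij j; rewrite !inE !eqxx orbT/= => /(_ isT) sj /(_ isT) si.
    case/orP: si => /eqP si.
      move/eqP: s1; case; apply/permP => k; rewrite perm1.
      have [->//|ki] := eqVneq k i; have [->|kj] := eqVneq k j.
        case/orP: sj => /eqP// sj; move: ij.
        by rewrite -(inj_eq (@perm_inj _ s)) si sj eqxx.
      by rewrite H'// !inE (negbTE ki) (negbTE kj).
    move/eqP: st; case; apply/permP => k.
    case: tpermP => [->//|->|/eqP ki /eqP kj].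
      case/orP: sj => /eqP// sj; move: ij.
      by rewrite -(inj_eq (@perm_inj _ s)) si sj eqxx.
    by rewrite H'// !inE (negbTE ki) (negbTE kj).
  by rewrite (@pminor_perm0 M _ s k) ?mulr0.
rewrite odd_perm1 odd_tperm ij expr0 expr1 mul1r mulN1r.
congr (_ - _); rewrite (bigD1 i)//= (bigD1 j)/= 1?eq_sym// big1 ?mulr1.
- by rewrite !mxE !perm1 !inE !eqxx orbT.
- by move=> k /andP[ki kj]; rewrite !mxE !perm1 !inE (negbTE ki) (negbTE kj) eqxx.
- by rewrite !mxE tpermL tpermR !inE !eqxx orbT.
- move=> k /andP[ki kj].
  by rewrite !mxE tpermD 1?eq_sym// !inE (negbTE ki) (negbTE kj) eqxx.
Qed.

End SquarefreeExpansion.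

(** * Duality between inverse eigenvectors and squarefree monomials *)

Section Orthogonality.
Variables (K : fieldType) (n : nat) (M : 'M[K]_n).
Implicit Types (x y : 'cV[K]_n).

Definition inv_eig x := forall k, x k 0 * (M *m x) k 0 = 1.

Lemma inv_eig_neq0 x : inv_eig x -> forall k, x k 0 != 0.
Proof.
move=> xV k; apply/eqP => xk0; have /eqP := xV k.
by rewrite xk0 mul0r eq_sym oner_eq0.
Qed.

Lemma det_D_neq0 x : inv_eig x -> \det (D x) != 0.
Proof.
move=> xV; rewrite det_diag; apply/prodf_neq0 => i _.
by rewrite mxE; apply: inv_eig_neq0.
Qed.

(** The two matrices are conjugate by [D x]. *)
Lemma det_hadamard_same x : inv_eig x ->
  \det (1%:M + D (hadamard x x) *m M) = \det (1%:M + D x *m M *m D x).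
Proof.
move=> xV; apply: (mulIf (det_D_neq0 xV)); rewrite [RHS]mulrC -!det_mulmx.
congr (\det _); apply/matrixP => i j.
rewrite mul_DE [in RHS]D_mulE ![(1%:M + _) i j]mxE mul_DE !D_mulE !mxE.
by have [->|_] := eqVneq i j; rewrite ?mulr1n ?mulr0n; ring.
Qed.

(** The matrix is singular because it kills [x - y]. *)
Lemma det_hadamard_diff x y : inv_eig x -> inv_eig y -> x != y ->
  \det (1%:M + D (hadamard x y) *m M) = 0.
Proof.
move=> xV yV xy; set A := 1%:M + _.
have Ak : A *m (x - y) = 0.
  apply/matrixP => k j; rewrite (ord1 j) /A mulmxDl mul1mx -mulmxA mulmxBr.
  rewrite [LHS]mxE D_mulE !mxE; have := xV k; have := yV k; rewrite !mxE.
  set a := \sum_j M k j * x j 0; set b := \sum_j M k j * y j 0.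
  by move=> e1 e2; transitivity (x k 0 * (1 - y k 0 * b) - y k 0 * (1 - x k 0 * a));
     [ring | rewrite e1 e2; ring].
apply/eqP; rewrite -det_tr; apply/det0P; exists (x - y)^T.
  by rewrite -trmx0 (inj_eq trmx_inj) subr_eq0.
by rewrite -trmx_mul Ak trmx0.
Qed.

(** This is Lagrange interpolation at the inverse eigenvectors: up to a factor
    depending on [y], the left side is the Bezoutian of the system
    [x_k (M x)_k = 1] at [(x, y)], which vanishes at pairs of distinct
    solutions and is the Jacobian on the diagonal. *)
Lemma sum_pminor_sqfree x y : inv_eig x -> inv_eig y ->
  \sum_(S : {set _}) pminor M S * (sqfree x S * sqfree y S) =
  if x == y then \det (1%:M + D x *m M *m D x) else 0.
Proof.
move=> xV yV; under eq_bigr do rewrite -sqfree_hadamard.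
rewrite -det_addD_expand; have [<-|xy] := eqVneq x y.
  exact: det_hadamard_same.
exact: det_hadamard_diff.
Qed.

(** With as many solutions as subsets, the matrices [B] of values of the
    monomials and [W] of weighted values are square; [sum_pminor_sqfree] is
    [B *m W = 1], and the conclusion is [W *m B = 1]. *)
Lemma weighted_sqfree_orthogonality (f : {set 'I_n} -> 'cV[K]_n) :
  injective f -> (forall S, inv_eig (f S)) ->
  (forall S, \det (1%:M + D (f S) *m M *m D (f S)) != 0) ->
  forall S T, pminor M S *
    (\sum_(U : {set _}) weight M (f U) * (sqfree (f U) S * sqfree (f U) T)) = (S == T)%:R.
Proof.
move=> finj fV fdet S T.
pose N := #|{set 'I_n}|.
pose B : 'M[K]_N := \matrix_(i, j) sqfree (f (enum_val i)) (enum_val j).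
pose W : 'M[K]_N := \matrix_(i, j)
  (pminor M (enum_val i) * weight M (f (enum_val j)) * sqfree (f (enum_val j)) (enum_val i)).
have BW : B *m W = 1%:M.
  apply/matrixP => i j; rewrite !mxE.
  transitivity (weight M (f (enum_val j)) *
    \sum_(S : {set _}) pminor M S * (sqfree (f (enum_val i)) S * sqfree (f (enum_val j)) S)).
    rewrite [in RHS](reindex _ (onW_bij _ (@enum_val_bij {set 'I_n})))/= mulr_sumr.
    by apply: eq_bigr => k _; rewrite !mxE; ring.
  rewrite sum_pminor_sqfree// (inj_eq finj) (inj_eq enum_val_inj) /weight.
  by have [->|] := eqVneq i j; rewrite ?mulr0// mulVf.
have /matrixP/(_ (enum_rank S) (enum_rank T)) := mulmx1C BW.
rewrite !mxE (inj_eq enum_rank_inj) => <-.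
rewrite [in LHS](reindex _ (onW_bij _ (@enum_val_bij {set 'I_n})))/= mulr_sumr.
by apply: eq_bigr => k _; rewrite !mxE !enum_rankK; ring.
Qed.

End Orthogonality.

(** * Positive semidefinite forms: positive weights, uniqueness in an orthant *)

Section RealQuadraticForms.
Variables (R : rcfType) (n : nat).
Implicit Types (M N : 'M[R]_n) (x y v : 'cV[R]_n).

Definition qform M x : R := (x^T *m M *m x) 0 0.
Definition psd M := forall x, 0 <= qform M x.
Definition sqnorm x : R := \sum_k x k 0 ^+ 2.

Lemma qformE M x : qform M x = \sum_k x k 0 * (M *m x) k 0.
Proof.
by rewrite /qform -mulmxA mxE; apply: eq_bigr => k _; rewrite mxE.
Qed.

Lemma qform1 x : qform 1%:M x = sqnorm x.
Proof. by rewrite qformE mul1mx; apply: eq_bigr => k _; rewrite expr2. Qed.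

Lemma sqnorm_ge0 x : 0 <= sqnorm x.
Proof. by apply: sumr_ge0 => k _; exact: sqr_ge0. Qed.

Lemma sqnorm_eq0 x : sqnorm x = 0 -> x = 0.
Proof.
move=> x0; apply/matrixP => k j; rewrite (ord1 j) mxE; apply/eqP.
rewrite -sqrf_eq0; apply/eqP; move: k isT.
by apply/psumr_eq0P => // k _; exact: sqr_ge0.
Qed.

Lemma qformD M N x : qform (M + N) x = qform M x + qform N x.
Proof. by rewrite /qform mulmxDr mulmxDl mxE. Qed.

Lemma qformZ a M x : qform (a *: M) x = a * qform M x.
Proof. by rewrite /qform -scalemxAr -scalemxAl mxE. Qed.

Lemma qformN M x : qform (- M) x = - qform M x.
Proof. by rewrite -scaleN1r qformZ mulN1r. Qed.
Lemma D_mulx (x y : 'cV[R]_n) : D x *m y = hadamard x y.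
Proof. by apply/matrixP => i j; rewrite D_mulE (ord1 j) mxE. Qed.

Lemma qform_congr M x y : qform (D x *m M *m D x) y = qform M (hadamard x y).
Proof.
by rewrite /qform -D_mulx trmx_mul tr_diag_mx !mulmxA.
Qed.

Lemma psd_congr M x : psd M -> psd (D x *m M *m D x).
Proof. by move=> M0 y; rewrite qform_congr. Qed.

(** The polynomial [det (1 + s N)] equals 1 at [s = 0] and has no root
    [s >= 0], since [1 + s N] is positive definite there; by the intermediate
    value property it is still positive at [s = 1]. *)
Lemma det_add1_psd_gt0 N : psd N -> 0 < \det (1%:M + N).
Proof.
move=> N0; pose p : {poly R} := \det (1%:M + 'X *: map_mx polyC N).
have pE s : p.[s] = \det (1%:M + s *: N).
  rewrite -horner_evalE -det_map_mx; congr (\det _); apply/matrixP => i j.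
  by rewrite !mxE rmorphD rmorphM rmorph_nat/= !horner_evalE hornerX hornerC.
have ps s : 0 <= s -> p.[s] != 0.
  move=> s0; rewrite pE -det_tr; apply/det0P => -[v v0 vs].
  have {}vs : (1%:M + s *: N) *m v^T = 0.
    by apply: trmx_inj; rewrite trmx_mul trmxK trmx0.
  have : qform (1%:M + s *: N) v^T = 0 by rewrite qformE vs big1// => k _; rewrite [X in _ * X]mxE mulr0.
  rewrite qformD qformZ qform1 => /eqP; rewrite paddr_eq0 ?sqnorm_ge0 ?mulr_ge0//.
  case/andP => /eqP/sqnorm_eq0 vT _; move/eqP: v0; apply.
  by apply: trmx_inj; rewrite trmx0.
rewrite ltNge -[N]scale1r -pE; apply/negP => p1.
have p0 : p.[0] = 1 by rewrite pE scale0r addr0 det1.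
have [s /andP[s0 _]] : exists2 s, 0 <= s <= 1 & root (- p) s.
  by apply: poly_ivt => //; rewrite !hornerN p0 oppr_le0 ler01 oppr_ge0.
by rewrite rootE hornerN oppr_eq0 (negbTE (ps _ s0)).
Qed.

Lemma weight_gt0 M x : psd M -> 0 < weight M x.
Proof. by move=> M0; rewrite invr_gt0 det_add1_psd_gt0//; exact: psd_congr. Qed.

(** Inverse eigenvectors have no zero coordinate, so the set of negative
    coordinates determines the open orthant that contains one. *)
Definition negset x : {set 'I_n} := [set k | x k 0 < 0]%SET.

Lemma same_sign_mul_gt0 M N x y : inv_eig M x -> inv_eig N y ->
  negset x = negset y -> forall k, 0 < x k 0 * y k 0.
Proof.
move=> xV yV xy k; have : (k \in negset x) = (k \in negset y) by rewrite xy.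
rewrite !inE.
have := inv_eig_neq0 xV k; have := inv_eig_neq0 yV k.
move=> y0 x0; case: (ltrgtP (x k 0) 0) x0 => //= xk _; case: (ltrgtP (y k 0) 0) y0 => //= yk _ _.
  by rewrite nmulr_rgt0.
exact: mulr_gt0.
Qed.

(** The pairing of [x - y] with [M x - N y], computed in two ways; on inverse
    eigenvectors [M x] and [N y] are the entrywise inverses of [x] and [y].  The
    case [M = N] gives uniqueness, the general case the dependence on the
    matrix. *)
Lemma inv_eig_diff_qform M N x y : inv_eig M x -> inv_eig N y ->
  \sum_k (x k 0 - y k 0) ^+ 2 / (x k 0 * y k 0) + qform M (x - y) =
  \sum_k (x k 0 - y k 0) * ((N - M) *m y) k 0.
Proof.
move=> xV yV; rewrite qformE -big_split/=; apply: eq_bigr => k _.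
rewrite mulmxBr mulmxBl !mxE.
have x0 := inv_eig_neq0 xV k; have y0 := inv_eig_neq0 yV k.
have := xV k; have := yV k; rewrite !mxE.
set a := \sum_j M k j * x j 0; set b := \sum_j N k j * y j 0.
set c := \sum_j M k j * y j 0.
move=> yb xa; have -> : b = (y k 0)^-1 by apply: (mulfI y0); rewrite yb mulfV.
have -> : a = (x k 0)^-1 by apply: (mulfI x0); rewrite xa mulfV.
by field; rewrite x0 y0.
Qed.

Lemma inv_eig_orthant_unique M x y : psd M -> inv_eig M x -> inv_eig M y ->
  negset x = negset y -> x = y.
Proof.
move=> M0 xV yV xy; have xy0 := same_sign_mul_gt0 xV yV xy.
have := inv_eig_diff_qform xV yV; rewrite subrr mul0mx.
rewrite [RHS]big1 => [/eqP|k _]; last by rewrite mxE mulr0.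
have t0 k : 0 <= (x k 0 - y k 0) ^+ 2 / (x k 0 * y k 0).
  by rewrite divr_ge0 ?sqr_ge0// ltW.
rewrite paddr_eq0//; last exact: sumr_ge0.
case/andP => /eqP/psumr_eq0P H _; apply/matrixP => k j; rewrite (ord1 j).
apply/eqP; rewrite -subr_eq0 -sqrf_eq0; apply/eqP.
by apply: (mulIf (invr_neq0 (lt0r_neq0 (xy0 k)))); rewrite mul0r H.
Qed.

End RealQuadraticForms.

(** * Continuity and compactness for column vectors *)

Section Continuity.
Variables (R : realType) (n : nat).

Lemma continuous_sum (T : topologicalType) (I : finType) (F : I -> T -> R) :
  (forall i, continuous (F i)) -> continuous (fun x => \sum_i F i x).
Proof.
by move=> Fc; apply: continuous_big => //; exact: add_continuous.
Qed.

Lemma continuous_prod (T : topologicalType) (I : finType) (F : I -> T -> R) :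
  (forall i, continuous (F i)) -> continuous (fun x => \prod_i F i x).
Proof.
by move=> Fc; apply: continuous_big => //; exact: mul_continuous.
Qed.

Lemma continuous_sqr (T : topologicalType) (f : T -> R) :
  continuous f -> continuous (fun z : T => f z ^+ 2).
Proof. by move=> fc z; exact: (continuousM (fc z) (fc z)). Qed.

Lemma continuous_sqnorm : continuous (@sqnorm R n).
Proof.
apply: continuous_sum => k; apply: continuous_sqr.
exact: coord_continuous.
Qed.
Lemma continuous_mulmx (M : 'M[R]_n) k :
  continuous (fun x : 'cV[R]_n => (M *m x) k 0).
Proof.
rewrite (_ : (fun _ => _) = (fun x : 'cV[R]_n => \sum_j M k j * x j 0)).
  apply: continuous_sum => j x; apply: continuousM; first exact: cst_continuous.
  exact: coord_continuous.
by apply/funext => x; rewrite mxE.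
Qed.

Lemma continuous_qform (M : 'M[R]_n) : continuous (qform M).
Proof.
rewrite (_ : qform M = (fun x : 'cV[R]_n => \sum_k x k 0 * (M *m x) k 0)).
  apply: continuous_sum => j x; apply: continuousM; first exact: coord_continuous.
  exact: continuous_mulmx.
by apply/funext => x; rewrite qformE.
Qed.

Lemma trmx_continuous (m p : nat) :
  continuous (trmx : 'M[R]_(m, p) -> 'M[R]_(p, m)).
Proof.
move=> x A [P Px sub]; exists (fun i j => P j i).
  by move=> i j; have := Px j i; rewrite mxE.
by move=> y yP; apply: sub => i j; rewrite mxE; exact: yP.
Qed.

Lemma compact_cube (r : R) :
  compact [set x : 'cV[R]_n | forall k, `|x k 0| <= r].
Proof.
have := @rV_compact R n (fun=> `[(- r), r]%classic) (fun=> @segment_compact _ _ _).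
move=> /(continuous_compact (continuous_subspaceT (@trmx_continuous 1 n))).
congr (compact _); apply/seteqP; split => [_ [y /= yr <-] k|x xr].
  by have := yr k; rewrite mxE in_itv/= ler_norml.
exists x^T; last by rewrite trmxK.
by move=> k /=; rewrite mxE in_itv/= -ler_norml.
Qed.

Lemma closed_le_fun (T : topologicalType) (f : T -> R) (a : R) :
  continuous f -> closed [set x | f x <= a].
Proof.
move=> fc; apply: (@closed_comp _ _ f [set y | y <= a]) => [x _|]; first exact: fc.
exact: closed_le.
Qed.

Lemma closed_ge_fun (T : topologicalType) (f : T -> R) (a : R) :
  continuous f -> closed [set x | a <= f x].
Proof.
move=> fc; apply: (@closed_comp _ _ f [set y | a <= y]) => [x _|]; first exact: fc.
exact: closed_ge.
Qed.

End Continuity.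

(** * Existence of an inverse eigenvector in each orthant *)

Section Existence.
Variables (R : realType) (n : nat).
Implicit Types (M N : 'M[R]_n) (x y : 'cV[R]_n).

Lemma qform_scale a M x : qform M (a *: x) = a ^+ 2 * qform M x.
Proof.
rewrite !qformE mulr_sumr; apply: eq_bigr => k _.
by rewrite -scalemxAr !mxE; ring.
Qed.

Lemma sqr_le_sqnorm x k : x k 0 ^+ 2 <= sqnorm x.
Proof.
rewrite /sqnorm (bigD1 k)//= lerDl; apply: sumr_ge0 => j _; exact: sqr_ge0.
Qed.

Lemma compact_sqnorm_le (A : set 'cV[R]_n) (r : R) : closed A ->
  (forall x, A x -> sqnorm x <= r) -> compact A.
Proof.
move=> Ac Ar; apply: (subclosed_compact Ac (@compact_cube R n (`|r| + 1))).
move=> x /Ar xr k.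
have r1 : 0 <= `|r| by [].
rewrite -ler_sqr ?nnegrE ?addr_ge0//.
rewrite real_normK ?num_real//.
apply: (le_trans (sqr_le_sqnorm x k)); apply: (le_trans xr).
apply: (le_trans (ler_norm r)); nra.
Qed.

Definition single_col k (t : R) : 'cV[R]_n := \col_i (t *+ (i == k)).

Lemma qform_add_single_col N x k t : N^T = N ->
  qform N (x + single_col k t) = qform N x + 2 * t * (N *m x) k 0 + t ^+ 2 * N k k.
Proof.
move=> Ns.
have sE (F : 'I_n -> R) : \sum_i (single_col k t) i 0 * F i = t * F k.
  rewrite (bigD1 k)//= mxE eqxx mulr1n big1 ?addr0// => i ik.
  by rewrite mxE (negbTE ik) mulr0n mul0r.
have NsE i : (N *m single_col k t) i 0 = t * N i k.
  by rewrite mxE -sE; apply: eq_bigr => j _; rewrite mulrC.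
rewrite !qformE; transitivity (\sum_i
    ((x i 0 * (N *m x) i 0 + x i 0 * (N *m single_col k t) i 0) +
     (single_col k t i 0 * (N *m x) i 0 + single_col k t i 0 * (N *m single_col k t) i 0))).
  by apply: eq_bigr => i _; rewrite mulmxDr [X in X * _]mxE [X in _ * X]mxE; ring.
rewrite !big_split/= !sE NsE.
have -> : \sum_i x i 0 * (N *m single_col k t) i 0 = t * (N *m x) k 0.
  rewrite mxE mulr_sumr; apply: eq_bigr => i _.
  by rewrite NsE -{1}Ns mxE; ring.
by ring.
Qed.

(** Positive definiteness with an explicit lower bound, which keeps the
    ellipsoids of [positive_inv_eig_exists] bounded. *)
Definition coercive t M := forall x, t * sqnorm x <= qform M x.

(** Maximize the product of the coordinates on the part of the ellipsoid
    [qform N x <= n] in the closed positive orthant.  The maximum is positive,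
    so the maximizer [c] has positive coordinates.  By homogeneity it satisfies
    the scale-free inequality [key], which, along the line through [c] in the
    [k]-th direction, says that a polynomial vanishing at 0 is nonnegative
    around 0; its derivative at 0 is a nonzero multiple of
    [c_k (N c)_k - 1]. *)
Lemma positive_inv_eig_exists N t : 0 < t -> N^T = N -> coercive t N ->
  exists2 x : 'cV[R]_n, (forall k, 0 < x k 0) & inv_eig N x.
Proof.
move=> t0 Ns Nt.
have [n0|n_gt0] := posnP n.
  by exists 0 => k; have := ltn_ord k; rewrite {2}n0.
have nR0 : (0 : R) < n%:R by rewrite ltr0n.
have N0 x : 0 <= qform N x.
  by apply: le_trans (Nt x); rewrite mulr_ge0 ?sqnorm_ge0// ltW.
have Npos x k : x k 0 != 0 -> 0 < qform N x.
  move=> xk; apply: lt_le_trans (Nt x); rewrite mulr_gt0//.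
  by apply: lt_le_trans (sqr_le_sqnorm x k); rewrite exprn_even_gt0.
pose A : set 'cV[R]_n := [set x : 'cV[R]_n | forall k, 0 <= x k 0] `&`
  [set x | qform N x <= n%:R].
have cA : compact A.
  apply: (@compact_sqnorm_le _ (n%:R / t)).
    apply: closedI; last exact/closed_le_fun/continuous_qform.
    rewrite (_ : mkset _ = \bigcap_k [set x : 'cV[R]_n | 0 <= x k 0]).
      apply: closed_bigI => k _; apply: closed_ge_fun; exact: coord_continuous.
    by apply/seteqP; split => [x xk k _|x xk k]; [exact: xk|exact: (xk k)].
  by move=> x [_ /= xn]; rewrite ler_pdivlMr// mulrC (le_trans (Nt x)).
pose f x : R := \prod_k x k 0.
have cf : continuous f by apply: continuous_prod => k; exact: coord_continuous.
have A0 : A !=set0.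
  exists 0; split => [k|]; first by rewrite mxE.
  by rewrite /= qformE big1// => k _; rewrite mxE mul0r.
have [c /set_mem[/= c0 cn] cmax] := compact_EVT_max A0 cA (continuous_subspaceT cf).
have fc0 : 0 < f c.
  (* The constant vector of entries [s] is small enough to lie in the ellipsoid. *)
  pose q1 := qform N (const_mx 1); pose s := (1 + q1)^-1.
  have q10 : 0 <= q1 by exact: N0.
  have s0 : 0 < s by rewrite invr_gt0 ltr_wpDr.
  apply: (@lt_le_trans _ _ (f (s *: const_mx 1))).
    by apply: prodr_gt0 => k _; rewrite !mxE mulr1.
  apply: cmax; apply/mem_set; split => [k|]; first by rewrite !mxE mulr1 ltW.
  rewrite /= qform_scale -/q1.
  apply: (@le_trans _ _ 1); last by rewrite ler1n.
  rewrite exprVn mulrC ler_pdivrMr ?mul1r ?exprn_gt0 ?ltr_wpDr//; nra.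
have cpos k : 0 < c k 0.
  rewrite lt_neqAle c0 andbT eq_sym; apply/eqP => ck.
  by move: fc0; rewrite /f (bigD1 k)//= ck mul0r ltxx.
have key y : (forall k, 0 <= y k 0) -> 0 < qform N y ->
    (f y) ^+ 2 * n%:R ^+ n <= (f c) ^+ 2 * (qform N y) ^+ n.
  (* The factor [l] brings [y] to the boundary of the ellipsoid. *)
  move=> y0 qy; pose l := Num.sqrt (n%:R / qform N y).
  have l2 : l ^+ 2 * qform N y = n%:R.
    by rewrite sqr_sqrtr ?divr_ge0 ?ltW// divfK// gt_eqF.
  have l0 : 0 <= l by exact: sqrtr_ge0.
  have lyA : l *: y \in A.
    apply/mem_set; split => [k|]; first by rewrite mxE mulr_ge0.
    by rewrite /= qform_scale l2.
  have flyE : f (l *: y) = l ^+ n * f y.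
    rewrite /f -[n in l ^+ n]card_ord -prodr_const -big_split/=.
    by apply: eq_bigr => k _; rewrite mxE.
  have fy0 : 0 <= f y by exact: prodr_ge0.
  have le2 : (l ^+ n * f y) ^+ 2 <= f c ^+ 2.
    rewrite ler_sqr ?nnegrE -?flyE; first exact: cmax.
      by rewrite flyE mulr_ge0// exprn_ge0.
    exact: ltW.
  rewrite -l2 exprMn mulrA; apply: ler_wpM2r; first by rewrite exprn_ge0 ?ltW.
  by apply: le_trans le2; rewrite [leRHS]exprMn mulrC -!exprM mulnC.
have k0 : 'I_n by exact: (Ordinal n_gt0).
have qc0 : 0 < qform N c by apply: (Npos _ k0); rewrite gt_eqF.
have qcn : qform N c = n%:R.
  apply/le_anti; rewrite cn/=.
  have := key c c0 qc0; rewrite ler_pM2l ?exprn_gt0//.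
  by rewrite ler_pXn2r// nnegrE ?ltW.
exists c => // k.
set l := (N *m c) k 0.
(* The inequality [key] at [c + u e_k], with the common factors removed. *)
pose p : {poly R} :=
  (c k 0 ^+ 2)%:P * (n%:R%:P + (2 * l) *: 'X + N k k *: 'X^2) ^+ n
  - ((c k 0)%:P + 'X) ^+ 2 * (n%:R ^+ n)%:P.
have pE u : p.[u] = c k 0 ^+ 2 * (n%:R + 2 * u * l + u ^+ 2 * N k k) ^+ n
   - (c k 0 + u) ^+ 2 * n%:R ^+ n.
  rewrite /p !hornerE; rewrite /=; congr (_ * _ ^+ _ - _); ring.
have p0 : p.[0] = 0 by rewrite pE mulr0 expr0n !mul0r !addr0 subrr.
have p_ge u : u \in `]- c k 0, c k 0[ -> p.[0] <= p.[u].
  rewrite in_itv/= => /andP[u1 u2]; rewrite p0 pE subr_ge0.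
  have yk : 0 < c k 0 + u by lra.
  pose y := c + single_col k u.
  have yE i : y i 0 = c i 0 + u *+ (i == k) by rewrite !mxE.
  have y0 i : 0 <= y i 0.
    rewrite yE; have [->|_] := eqVneq i k; first by rewrite ltW.
    by rewrite mulr0n addr0.
  have qy : 0 < qform N y by apply: (Npos _ k); rewrite yE eqxx gt_eqF.
  have := key y y0 qy.
  rewrite qform_add_single_col// qcn /f (bigD1 k)//= [in X in _ <= X](bigD1 k)//=.
  rewrite yE eqxx mulr1n (eq_bigr (fun i => c i 0)) => [|i ik]; last first.
    by rewrite yE (negbTE ik) mulr0n addr0.
  set P := \prod_(i | _) _ => h.
  have P0 : 0 < P by apply: prodr_gt0 => i _.
  rewrite -(@ler_pM2l _ (P ^+ 2)) ?exprn_gt0//.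
  move: h; rewrite -/l; move: (_ ^+ n) => Q; move: (_ ^+ n) => Z.
  congr (_ <= _); ring.
have dp : is_derive (0 : R) 1 (horner p) 0.
  apply: (@derive1_at_min _ (horner p) (- c k 0) (c k 0)) => //.
  - by have := cpos k; lra.
  - by rewrite in_itv/= oppr_lt0 cpos.
have : p^`().[0] = 0.
  by have := @derive_val _ _ _ _ _ _ _ (is_derive_poly p 0); rewrite derive_val.
rewrite /p !(poly.derivE, poly.deriv_exp) !hornerE /= ?hornerMn !hornerE /=.
rewrite !mulr0 addr0 -mulr_natr -[2 * l * _ * _]mulrA -exprSr prednK//.
have nn0 : n%:R ^+ n != 0 :> R by rewrite expf_neq0// gt_eqF.
have ck0 : c k 0 != 0 by rewrite gt_eqF.
set m := n%:R ^+ n in nn0 * => h.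
have : (2 * c k 0 * m) * (c k 0 * l - 1) = 0 by rewrite -[RHS]h; ring.
move=> /eqP; rewrite mulf_eq0 !mulf_eq0 (negbTE nn0) (negbTE ck0) !orbF pnatr_eq0/=.
by rewrite subr_eq0 => /eqP.
Qed.

(** Flipping signs by a diagonal matrix [D e] moves any orthant to the positive
    one and preserves coercivity. *)
Lemma inv_eig_exists M t (U : {set 'I_n}) : 0 < t -> M^T = M -> coercive t M ->
  exists2 x : 'cV[R]_n, inv_eig M x & negset x = U.
Proof.
move=> t0 Ms Mt.
pose e : 'cV[R]_n := \col_k (if k \in U then -1 else 1).
have ee k : e k 0 * e k 0 = 1 by rewrite mxE; case: ifP => _; ring.
have [x x0 xV] : exists2 x : 'cV[R]_n, (forall k, 0 < x k 0) &
    inv_eig (D e *m M *m D e) x.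
  apply: (@positive_inv_eig_exists _ t) => //.
    by rewrite !trmx_mul !tr_diag_mx Ms mulmxA.
  move=> x; rewrite qform_congr.
  have -> : sqnorm x = sqnorm (hadamard e x); last exact: Mt.
  apply: eq_bigr => k _; rewrite mxE exprMn [e k 0 ^+ 2]expr2 ee mul1r//.
exists (hadamard e x).
  move=> k; have := xV k.
  by rewrite -mulmxA D_mulx -mulmxA D_mulE [hadamard e x k 0]mxE => <-; ring.
apply/finset.setP => k; rewrite inE !mxE; case: ifP => kU.
  by rewrite mulN1r oppr_lt0 x0.
by rewrite mul1r ltNge ltW.
Qed.

End Existence.

(** * Moment bounds for coercive forms *)

Section FiniteSums.
Variables (R : realDomainType) (I : finType).

Lemma sqr_sum_le (a : I -> R) : (\sum_i a i) ^+ 2 <= #|I|%:R * \sum_i a i ^+ 2.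
Proof.
have h : 0 <= \sum_i \sum_j (a i - a j) ^+ 2.
  by apply: sumr_ge0 => i _; apply: sumr_ge0 => j _; exact: sqr_ge0.
suff e : \sum_i \sum_j (a i - a j) ^+ 2 =
    2 * (#|I|%:R * \sum_i a i ^+ 2 - (\sum_i a i) ^+ 2).
  by move: h; rewrite e pmulr_rge0// subr_ge0.
transitivity (\sum_i (#|I|%:R * a i ^+ 2 - 2 * (a i * \sum_j a j)
    + \sum_j a j ^+ 2)).
  apply: eq_bigr => i _.
  transitivity (\sum_j (a i ^+ 2 - 2 * (a i * a j) + a j ^+ 2)).
    by apply: eq_bigr => j _; ring.
  rewrite 2!big_split/= sumr_const -[_ *+ #|_|]mulr_natl sumrN.
  by rewrite -!mulr_sumr.
rewrite 2!big_split/= sumr_const -[_ *+ #|_|]mulr_natl sumrN -!mulr_sumr -mulr_suml.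
by ring.
Qed.

End FiniteSums.

Section MomentBounds.
Variables (R : realType) (n : nat) (N : 'M[R]_n) (t : R).
Hypotheses (t0 : 0 < t) (Ns : N^T = N) (Nt : coercive t N)
  (Nd : forall k, N k k = 1).

Let psdN : psd N.
Proof.
by move=> x; apply: le_trans (Nt x); rewrite mulr_ge0 ?sqnorm_ge0// ltW.
Qed.

Lemma coercive_moments (f : {set 'I_n} -> 'cV[R]_n) :
  (forall U, inv_eig N (f U) /\ negset (f U) = U) ->
  forall S T, pminor N S *
    (\sum_(U : {set _}) weight N (f U) * (sqfree (f U) S * sqfree (f U) T)) = (S == T)%:R.
Proof.
move=> fP; apply: weighted_sqfree_orthogonality => [U V fUV|U|U].
- by rewrite -(fP U).2 fUV (fP V).2.
- exact: (fP U).1.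
- by rewrite gt_eqF// det_add1_psd_gt0//; exact: psd_congr.
Qed.

(** The diagonal case of the duality is a sum of nonnegative terms equal to the
    inverse of the minor, so it bounds each of its terms. *)
Lemma coercive_weight_sqfree_le x S : inv_eig N x -> 0 < pminor N S ->
  weight N x * sqfree x S ^+ 2 <= (pminor N S)^-1.
Proof.
move=> xV NS.
have fP U : exists y, inv_eig N y /\ negset y = U.
  by have [y yV yU] := inv_eig_exists U t0 Ns Nt; exists y.
have [f {}fP] := choice fP.
have := coercive_moments fP S S; rewrite eqxx => /(canRL (mulKf (lt0r_neq0 NS))).
rewrite mulr1 => <-; rewrite (bigD1 (negset x))//=.
have -> : f (negset x) = x.
  by have [yV yx] := fP (negset x); apply: inv_eig_orthant_unique yx.
rewrite -expr2 lerDl; apply: sumr_ge0 => U _.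
by rewrite -expr2 mulr_ge0 ?sqr_ge0// ltW// weight_gt0.
Qed.

Lemma coercive_weight_le1 x : inv_eig N x -> weight N x <= 1.
Proof.
move=> xV; have := @coercive_weight_sqfree_le x finset.set0 xV.
by rewrite pminor0 sqfree0 expr1n invr1 mulr1; apply.
Qed.

(** The bound depends on [N] only through [kappa], hence holds uniformly along
    the deformation used below. *)
Lemma coercive_weight_sqnorm_le x (kappa : R) : 0 < kappa ->
  (forall k l, k != l -> N k l ^+ 2 <= 1 - kappa) -> inv_eig N x ->
  weight N x * sqnorm x ^+ 2 <= n%:R ^+ 4 * (1 + kappa^-1).
Proof.
move=> kappa0 Noff xV; set w := weight N x; set B := 1 + kappa^-1.
have w0 : 0 <= w by rewrite ltW// weight_gt0.
have w1 : w <= 1 by exact: coercive_weight_le1.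
have B1 : 1 <= B by rewrite lerDl invr_ge0 ltW.
have wij i j : i != j -> w * (x i 0 ^+ 2 * x j 0 ^+ 2) <= kappa^-1.
  move=> ij; have := @coercive_weight_sqfree_le x [set i; j]%SET xV.
  rewrite pminor2// sqfree2// !Nd mulr1.
  have -> : N j i = N i j by rewrite -{1}Ns mxE.
  rewrite -expr2 exprMn => H; apply: (le_trans (H _)).
    by rewrite subr_gt0; have := Noff _ _ ij; lra.
  by rewrite lef_pV2 ?posrE; have := Noff _ _ ij; lra.
have wi4 i : w * (x i 0 ^+ 2) ^+ 2 <= n%:R * (n%:R * B).
  (* The [a j] add up to [x_i ^+ 2], by the [i]-th equation and [N i i = 1]. *)
  pose a j := if j == i then 1 else - (N i j * x i 0 * x j 0).
  have -> : x i 0 ^+ 2 = \sum_j a j.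
    rewrite (bigD1 i)//= {1}/a eqxx -[X in X + _](xV i) mxE (bigD1 i)//= Nd mul1r.
    rewrite mulrDr -expr2 mulr_sumr -addrA -big_split/= big1 ?addr0// => j ji.
    by rewrite /a (negbTE ji); ring.
  apply: (le_trans (ler_wpM2l w0 (sqr_sum_le a))).
  rewrite card_ord mulrCA ler_wpM2l// mulr_sumr.
  rewrite -[n in leRHS]card_ord mulr_natl -sumr_const; apply: ler_sum => j _.
  rewrite /a; have [_|ji] := eqVneq j i.
    by rewrite expr1n mulr1 (le_trans w1).
  have ij : i != j by rewrite eq_sym.
  have N1 : N i j ^+ 2 <= 1 by have := Noff _ _ ij; lra.
  apply: (@le_trans _ _ (w * (x i 0 ^+ 2 * x j 0 ^+ 2))).
    rewrite ler_wpM2l// sqrrN !exprMn -mulrA ler_piMl// mulr_ge0 ?sqr_ge0//.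
  by apply: (le_trans (wij _ _ ij)); rewrite lerDr.
rewrite (le_trans (ler_wpM2l w0 (sqr_sum_le _)))// card_ord mulrCA.
apply: (@le_trans _ _ (n%:R * \sum_(i < n) (n%:R * (n%:R * B)))).
  by rewrite ler_wpM2l// mulr_sumr; apply: ler_sum => i _; exact: wi4.
by rewrite sumr_const card_ord -mulr_natl; lra.
Qed.

End MomentBounds.

(** * Deformation to the identity matrix *)

Section Deformation.
Variables (R : realType) (n : nat) (M : 'M[R]_n).
Implicit Types (x y : 'cV[R]_n) (t : R).

Definition deform t : 'M[R]_n := M + t *: (1%:M - M).

Lemma deform_sym t : M^T = M -> (deform t)^T = deform t.
Proof. by move=> Ms; apply/matrixP => i j; rewrite !mxE eq_sym -{1 2}Ms !mxE. Qed.

Lemma deform_diag t : (forall k, M k k = 1) -> forall k, deform t k k = 1.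
Proof. by move=> Md k; rewrite !mxE Md eqxx subrr mulr0 addr0. Qed.

Lemma deform_off t k l : k != l -> deform t k l = (1 - t) * M k l.
Proof. by move=> kl; rewrite !mxE (negbTE kl) mulr0n; ring. Qed.

Lemma deform_coercive t : psd M -> 0 <= t <= 1 -> coercive t (deform t).
Proof.
move=> M0 /andP[t0 t1] x; rewrite qformD qformZ qformD qform1 qformN.
by have := M0 x; nra.
Qed.

(** An inverse eigenvector persists.  With [s] the l1-distance from [x] to [y],
    and [b] bounding the entries of [y] and of [(M - 1) y],
    [inv_eig_diff_qform] bounds the sum of the [(x_k - y_k)^2 / (x_k y_k)] by
    [t b s]; since [x_k y_k <= b^2 + s b], this gives
    [s <= L t (b + s)], which for small [t] forces [s = O(t)]. *)
Lemma inv_eig_deform_stable y : psd M -> inv_eig M y ->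
  exists L C : R, forall t x, 0 <= t <= 1 -> L * t <= 1 / 2 ->
    inv_eig (deform t) x -> negset x = negset y ->
    forall k, `|x k 0 - y k 0| <= C * t.
Proof.
move=> M0 yV; pose w := (M - 1%:M) *m y.
pose b := \sum_k `|y k 0| + \sum_k `|w k 0|.
have yb k : `|y k 0| <= b.
  rewrite /b (bigD1 k)//= -addrA lerDl addr_ge0 ?sumr_ge0//.
have wb k : `|w k 0| <= b.
  rewrite /b addrC (bigD1 k)//= -addrA lerDl addr_ge0 ?sumr_ge0//.
have b0 : 0 <= b by rewrite addr_ge0 ?sumr_ge0.
exists (n%:R ^+ 2 * b ^+ 2), (2 * (n%:R ^+ 2 * b ^+ 2) * b) => t x t01 Lt xV xy.
move: (t01) => /andP[t0 t1].
set L := n%:R ^+ 2 * b ^+ 2 in Lt *.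
have L0 : 0 <= L by rewrite mulr_ge0 ?sqr_ge0 ?exprn_ge0.
pose s := \sum_k `|x k 0 - y k 0|.
have s0 : 0 <= s by rewrite sumr_ge0.
suff ss : s <= L * t * (b + s).
  move=> k; apply: (@le_trans _ _ s).
    by rewrite /s (bigD1 k)//= lerDl sumr_ge0.
  have : (1 - L * t) * s <= L * t * b by nra.
  have : (1 / 2) * s <= (1 - L * t) * s by rewrite ler_wpM2r//; lra.
  by lra.
have xy0 := same_sign_mul_gt0 xV yV xy.
have sum_le : \sum_k (x k 0 - y k 0) ^+ 2 / (x k 0 * y k 0) <= t * b * s.
  have q0 : 0 <= qform (deform t) (x - y).
    apply: le_trans (deform_coercive M0 t01 _).
    by rewrite mulr_ge0 ?sqnorm_ge0.
  apply: (@le_trans _ _ (\sum_k (x k 0 - y k 0) * ((M - deform t) *m y) k 0)).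
    by rewrite -(inv_eig_diff_qform xV yV) lerDl.
  rewrite [t * b * s]mulr_sumr; apply: ler_sum => k _.
  have -> : M - deform t = t *: (M - 1%:M).
    by rewrite /deform opprD addrA subrr sub0r -scalerN opprB.
  rewrite -scalemxAl mxE -/w mulrCA -mulrA ler_wpM2l//.
  apply: (le_trans (ler_norm _)); rewrite normrM mulrC ler_wpM2r//.
have term_le k : (x k 0 - y k 0) ^+ 2 <= (b ^+ 2 + s * b) * (t * b * s).
  have -> : (x k 0 - y k 0) ^+ 2 = (x k 0 * y k 0) *
      ((x k 0 - y k 0) ^+ 2 / (x k 0 * y k 0)).
    by rewrite mulrC divfK// gt_eqF.
  have h0 j : 0 <= (x j 0 - y j 0) ^+ 2 / (x j 0 * y j 0).
    by rewrite divr_ge0 ?sqr_ge0// ltW.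
  apply: ler_pM => //; first by rewrite ltW.
    have -> : x k 0 * y k 0 = y k 0 ^+ 2 + (x k 0 - y k 0) * y k 0 by ring.
    apply: lerD.
      rewrite -[y k 0 ^+ 2]ger0_norm ?sqr_ge0// normrX.
      by rewrite ler_sqr ?nnegrE// yb.
    apply: (le_trans (ler_norm _)); rewrite normrM ler_pM//.
    by rewrite /s (bigD1 k)//= lerDl sumr_ge0.
  apply: le_trans sum_le.
  rewrite [leRHS](bigD1 k)//= lerDl sumr_ge0//.
have s2 : s ^+ 2 <= (L * t * (b + s)) * s.
  apply: (le_trans (sqr_sum_le _)); rewrite card_ord.
  apply: (@le_trans _ _ (n%:R * \sum_(k < n) ((b ^+ 2 + s * b) * (t * b * s)))).
    rewrite ler_wpM2l//; apply: ler_sum => k _.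
    by rewrite real_normK ?num_real.
  by rewrite sumr_const card_ord -mulr_natl /L; lra.
have [->|sn0] := eqVneq s 0.
  by rewrite addr0 !mulr_ge0.
have sp : 0 < s by rewrite lt_neqAle eq_sym sn0.
by rewrite -(ler_pM2r sp) -expr2.
Qed.

(** On the compact set [A] of points of the closed orthant with
    [sqnorm x <= r], the residual [g] of the equations for [M] has a positive
    minimum, as a zero would be an inverse eigenvector.  At an inverse
    eigenvector of [deform t] it equals [t^2 h], with [h] bounded on [A], so for
    small [t] such a point lies outside [A]. *)
Lemma inv_eig_deform_escape (U : {set 'I_n}) :
  ~ (exists x, inv_eig M x /\ negset x = U) ->
  forall r, exists2 d : R, 0 < d & forall t x, 0 <= t -> t < d ->
    inv_eig (deform t) x -> negset x = U -> r < sqnorm x.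
Proof.
move=> noU r.
pose e : 'cV[R]_n := \col_k (if k \in U then -1 else 1).
pose A : set 'cV[R]_n := [set x : 'cV[R]_n | forall k, 0 <= e k 0 * x k 0] `&`
  [set x | sqnorm x <= r].
have [r0|r0] := ltP r 0.
  by exists 1 => // t x _ _ _ _; rewrite (lt_le_trans r0)// sqnorm_ge0.
have cA : compact A.
  apply: (@compact_sqnorm_le _ _ _ r) => [|x []//].
  apply: closedI; last exact/closed_le_fun/continuous_sqnorm.
  rewrite (_ : mkset _ = \bigcap_k [set x : 'cV[R]_n | 0 <= e k 0 * x k 0]).
    apply: closed_bigI => k _; apply: closed_ge_fun => x.
    apply: continuousM; [exact: cst_continuous | exact: coord_continuous].
  by apply/seteqP; split => [x xk k _|x xk k]; [exact: xk|exact: (xk k)].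
have A0 : A !=set0.
  exists 0; split => [k|]; first by rewrite [X in _ * X]mxE mulr0.
  by rewrite /= /sqnorm big1// => k _; rewrite mxE expr0n.
pose g x := \sum_k (x k 0 * (M *m x) k 0 - 1) ^+ 2.
pose h x := \sum_k (x k 0 * ((1%:M - M) *m x) k 0) ^+ 2.
have cg : continuous g.
  apply: continuous_sum => k; apply: continuous_sqr => x.
  apply: (@continuousB R _ _ (fun z : 'cV[R]_n => z k 0 * (M *m z) k 0) (cst 1)); last exact: cst_continuous.
  by apply: continuousM; [exact: coord_continuous|exact: continuous_mulmx].
have ch : continuous h.
  apply: continuous_sum => k; apply: continuous_sqr => x.
  by apply: continuousM; [exact: coord_continuous|exact: continuous_mulmx].
have [c /set_mem[/= c1 c2] cmin] := compact_EVT_min A0 cA (continuous_subspaceT cg).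
have [d _ dmax] := compact_EVT_max A0 cA (continuous_subspaceT ch).
have g0 x : 0 <= g x by apply: sumr_ge0 => k _; exact: sqr_ge0.
have h0 x : 0 <= h x by apply: sumr_ge0 => k _; exact: sqr_ge0.
have gc0 : 0 < g c.
  rewrite lt_neqAle g0 andbT eq_sym; apply/eqP => gc; apply: noU.
  have cV : inv_eig M c.
    move=> k; apply/eqP; rewrite -subr_eq0 -sqrf_eq0; apply/eqP; move: k isT.
    by apply/psumr_eq0P => // k _; exact: sqr_ge0.
  exists c; split => //; apply/finset.setP => k; rewrite inE.
  have := c1 k; rewrite mxE; have := inv_eig_neq0 cV k; case: ifP => _.
    by rewrite mulN1r oppr_ge0 lt_neqAle => -> ->.
  by rewrite mul1r => _ ck; rewrite ltNge ck.
have hd1 : 0 < 1 + h d by rewrite ltr_wpDr.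
exists (Num.min 1 (g c / (1 + h d))).
  by rewrite lt_min ltr01 divr_gt0.
move=> t x t0; rewrite lt_min ltr_pdivlMr// => /andP[t1 tg] xV xU.
rewrite ltNge; apply/negP => xr.
have xA : x \in A.
  apply/mem_set; split => //= k; rewrite mxE -xU inE.
  by case: ltP => xk; rewrite ?mulN1r ?mul1r// oppr_ge0 ltW.
have gx : g x = t ^+ 2 * h x.
  rewrite /g /h mulr_sumr; apply: eq_bigr => k _; rewrite -exprMn -[RHS]sqrrN.
  congr (_ ^+ 2); have xk := xV k.
  rewrite /deform mulmxDl -scalemxAl [X in _ * X]mxE [X in _ + X]mxE in xk.
  by lra.
have := cmin x xA; rewrite gx; have := dmax x xA => hx gc.
have : t ^+ 2 * h x <= t * (1 + h d).
  have : t ^+ 2 * h x <= t ^+ 2 * h d by rewrite ler_wpM2l// sqr_ge0.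
  have : t ^+ 2 * h d <= t * h d by rewrite ler_wpM2r// expr2 ler_piMr// ltW.
  by lra.
by lra.
Qed.

End Deformation.

(** * Passage to the limit *)

Section Convergence.
Variables (R : realType) (n : nat).

Lemma cvg_det (B_ : nat -> 'M[R]_n) (B : 'M[R]_n) :
  (forall i j, B_ m i j @[m --> \oo] --> B i j) ->
  \det (B_ m) @[m --> \oo] --> \det B.
Proof.
move=> Bc; apply: cvg_big => [|s _]; first exact: add_continuous.
apply: cvgM; first exact: cvg_cst.
by apply: cvg_big => [|i _]; [exact: mul_continuous|exact: Bc].
Qed.

Lemma cvg_weight (N_ : nat -> 'M[R]_n) (N : 'M[R]_n)
    (x_ : nat -> 'cV[R]_n) (x : 'cV[R]_n) :
  psd N -> (forall i j, N_ m i j @[m --> \oo] --> N i j) ->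
  (forall k, x_ m k 0 @[m --> \oo] --> x k 0) ->
  weight (N_ m) (x_ m) @[m --> \oo] --> weight N x.
Proof.
move=> N0 Nc xc; apply: cvgV.
  by rewrite gt_eqF// det_add1_psd_gt0//; exact: psd_congr.
apply: cvg_det => i j.
under eq_cvg do rewrite mxE mul_DE D_mulE; rewrite mxE mul_DE D_mulE.
apply: cvgD; first exact: cvg_cst.
by do 2?apply: cvgM.
Qed.

Lemma cvg_sqfree (x_ : nat -> 'cV[R]_n) (x : 'cV[R]_n) (S : {set 'I_n}) :
  (forall k, x_ m k 0 @[m --> \oo] --> x k 0) ->
  sqfree (x_ m) S @[m --> \oo] --> sqfree x S.
Proof.
by move=> xc; apply: cvg_big => [|i _]; [exact: mul_continuous|exact: xc].
Qed.

End Convergence.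

Section LowDegree.
Variables (R : realType) (n : nat).
Implicit Types (M : 'M[R]_n) (x : 'cV[R]_n) (S T : {set 'I_n}).

Lemma card_le1_cases S : (#|S| <= 1)%N ->
  S = finset.set0 \/ exists k, S = [set k]%SET.
Proof.
rewrite leq_eqVlt ltnS leqn0 => /orP[/cards1P[k ->]|]; first by right; exists k.
by rewrite cards_eq0 => /eqP; left.
Qed.

Lemma pminor_le1 M S : (forall k, M k k = 1) -> (#|S| <= 1)%N -> pminor M S = 1.
Proof.
by move=> Md /card_le1_cases[->|[k ->]]; rewrite ?pminor0 ?pminor1.
Qed.

Lemma sqfree_sqr_le x S : (#|S| <= 1)%N -> sqfree x S ^+ 2 <= 1 + sqnorm x.
Proof.
move=> /card_le1_cases[->|[k ->]].
  by rewrite sqfree0 expr1n lerDl sqnorm_ge0.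
by rewrite sqfree1 (le_trans (sqr_le_sqnorm x k))// lerDr.
Qed.

Lemma sqfree_mul_le x S T : (#|S| <= 1)%N -> (#|T| <= 1)%N ->
  `|sqfree x S * sqfree x T| <= 1 + sqnorm x.
Proof.
move=> /(sqfree_sqr_le x) S1 /(sqfree_sqr_le x) T1.
set a := sqfree x S in S1 *; set b := sqfree x T in T1 *.
by rewrite ler_norml; apply/andP; split; nra.
Qed.

End LowDegree.

Section Moments.
Variables (R : realType) (n : nat) (M : 'M[R]_n).
Hypotheses (hM : correlation_mx M)
  (hoff : forall k l : 'I_n, k != l -> `|M k l| < 1).

(** The inverse eigenvector of [N] in the orthant with negative coordinates
    [U]; it has a junk value when [U] is not in [orthants N]. *)
Definition solution N (U : {set 'I_n}) : 'cV[R]_n :=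
  xget 0 [set x | inv_eig N x /\ negset x = U].

Definition orthants N : {set {set 'I_n}} :=
  [set U | `[< exists x : 'cV[R]_n, inv_eig N x /\ negset x = U >]]%SET.

Lemma solutionP N U : (exists x, inv_eig N x /\ negset x = U) ->
  inv_eig N (solution N U) /\ negset (solution N U) = U.
Proof. by move=> /(@xgetPex _ 0). Qed.

Let Msym : M^T = M. Proof. by case: hM. Qed.
Let Mpsd : psd M. Proof. by case: hM. Qed.
Let Mdiag k : M k k = 1. Proof. by case: hM. Qed.

(** A common gap for all off-diagonal entries is inherited by every deformed
    matrix ([deform_off_le]) and makes the moment bounds uniform. *)
Lemma off_diagonal_gap : exists2 kappa : R, 0 < kappa &
  forall k l, k != l -> M k l ^+ 2 <= 1 - kappa.
Proof.
exists (\big[Order.min/1]_(p : 'I_n * 'I_n | p.1 != p.2) (1 - M p.1 p.2 ^+ 2)).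
  apply: lt_bigmin => // -[k l] /= /hoff kl.
  by rewrite subr_gt0 -real_normK ?num_real// expr_lt1.
move=> k l kl; rewrite lerBrDl -lerBrDr.
exact: (@bigmin_le_cond _ _ _ 1 (k, l) (fun p => p.1 != p.2)
  (fun p => 1 - M p.1 p.2 ^+ 2)).
Qed.

Lemma deform_off_le (kappa t : R) k l : 0 <= t <= 1 -> k != l ->
  M k l ^+ 2 <= 1 - kappa -> deform M t k l ^+ 2 <= 1 - kappa.
Proof.
move=> /andP[t0 t1] kl Mk; rewrite deform_off// exprMn.
apply: le_trans Mk; rewrite ler_piMl ?sqr_ge0//; nra.
Qed.

Let t_ (m : nat) : R := m.+1%:R^-1.

Let t_gt0 m : 0 < t_ m. Proof. by rewrite invr_gt0. Qed.

Let t_01 m : 0 <= t_ m <= 1.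
Proof. by rewrite ltW// invf_le1// ler1n. Qed.

Let cvg_t : t_ @ \oo --> (0 : R).
Proof. exact: cvg_harmonic. Qed.

Let a_ m := solution (deform M (t_ m)).

Let a_P m U : inv_eig (deform M (t_ m)) (a_ m U) /\ negset (a_ m U) = U.
Proof.
apply: solutionP.
have [x xV xU] := inv_eig_exists U (t_gt0 m) (deform_sym (t_ m) Msym)
  (deform_coercive Mpsd (t_01 m)).
by exists x.
Qed.

Lemma deformed_coord_cvg (U : {set 'I_n}) k : U \in orthants M ->
  a_ m U k 0 @[m --> \oo] --> solution M U k 0.
Proof.
rewrite inE => /asboolP/solutionP[]; set b := solution M U => bV bU.
have [L [C LC]] := inv_eig_deform_stable Mpsd bV.
have near_le : \forall m \near \oo, `|a_ m U k 0 - b k 0| <= C * t_ m.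
  have Lt : L * t_ m @[m --> \oo] --> L * 0 by apply: cvgMr.
  rewrite mulr0 in Lt; have h2 : (0 : R) < 1 / 2 by lra.
  near=> m; have [aV aU] := a_P m U.
  apply: (LC (t_ m)) => //; last by rewrite aU bU.
  near: m; exact: (cvgr_le _ Lt).
have Ct : C * t_ m @[m --> \oo] --> (0 : R).
  by rewrite -(mulr0 C); apply: cvgMr.
apply: (@squeeze_cvgr _ _ _ _ (fun m => b k 0 - C * t_ m) (fun m => b k 0 + C * t_ m)).
- near=> m; have : `|a_ m U k 0 - b k 0| <= C * t_ m by near: m.
  by rewrite ler_distlC addrC -lerBlDr; case/andP => h1 h2; apply/andP; split; lra.
- by rewrite -[X in _ --> X]subr0; apply: cvgB => //; exact: cvg_cst.
- by rewrite -[X in _ --> X]addr0; apply: cvgD => //; exact: cvg_cst.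
Unshelve. all: by end_near. Qed.

(** For degree at most two, the integrand is dominated by [1 + sqnorm], whereas
    the weight is of order at most [sqnorm ^- 2] by
    [coercive_weight_sqnorm_le]. *)
Lemma deformed_escape_cvg0 (U S T : {set 'I_n}) : (#|S| <= 1)%N -> (#|T| <= 1)%N ->
  U \notin orthants M ->
  weight (deform M (t_ m)) (a_ m U) * (sqfree (a_ m U) S * sqfree (a_ m U) T)
    @[m --> \oo] --> (0 : R).
Proof.
move=> S1 T1; rewrite inE => /asboolPn noU.
have [kappa kappa0 Mkappa] := off_diagonal_gap.
pose K := n%:R ^+ 4 * (1 + kappa^-1).
have K0 : 0 <= K by rewrite mulr_ge0 ?exprn_ge0 ?addr_ge0 ?invr_ge0 ?(ltW kappa0).
apply/cvgr0Pnorm_lt => e e0.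
have [d d0 Hd] := inv_eig_deform_escape noU (1 + 2 * K / e).
near=> m; have [aV aU] := a_P m U.
have td : t_ m < d by near: m; exact: (cvgr_lt _ cvg_t).
have := Hd _ _ (ltW (t_gt0 m)) td aV aU.
set w := weight _ _; set s := sqnorm _ => sbig.
have w0 : 0 < w.
  apply: weight_gt0 => x; apply: le_trans (deform_coercive Mpsd (t_01 m) x).
  by rewrite mulr_ge0 ?sqnorm_ge0// ltW.
have wK : w * s ^+ 2 <= K.
  apply: (@coercive_weight_sqnorm_le _ _ _ (t_ m)) => //.
  - exact: deform_sym.
  - exact: deform_coercive.
  - exact: deform_diag.
  - by move=> k l kl; apply: deform_off_le => //; exact: Mkappa.
rewrite normrM gtr0_norm//.
apply: (@le_lt_trans _ _ (w * (1 + s))).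
  by rewrite ler_wpM2l ?sqfree_mul_le// ltW.
have Ke : 0 <= 2 * K / e by apply: divr_ge0; [rewrite mulr_ge0|exact: ltW].
have Kee : 2 * K / e * e = 2 * K by rewrite divfK// gt_eqF.
set q := 2 * K / e in sbig Ke Kee.
have s1 : 1 < s by lra.
apply: (@le_lt_trans _ _ (2 * (w * s))); first by nra.
rewrite -(@ltr_pM2r _ s); last by lra.
apply: (@le_lt_trans _ _ (2 * K)); first by nra.
rewrite -Kee mulrC ltr_pM2l//; lra.
Unshelve. all: by end_near. Qed.

(** The duality holds for each deformed matrix, with all [2^n] orthants; in the
    limit only the orthants in [orthants M] survive. *)
Lemma real_moments (S T : {set 'I_n}) : (#|S| <= 1)%N -> (#|T| <= 1)%N ->
  \sum_(U in orthants M) weight M (solution M U) *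
    (sqfree (solution M U) S * sqfree (solution M U) T) = (S == T)%:R.
Proof.
move=> S1 T1.
pose g m U := weight (deform M (t_ m)) (a_ m U) *
  (sqfree (a_ m U) S * sqfree (a_ m U) T).
have gsum m : \sum_U g m U = (S == T)%:R.
  have <- := @coercive_moments _ _ _ _ (t_gt0 m) (deform_coercive Mpsd (t_01 m)) _ (a_P m) S T.
  by rewrite pminor_le1 ?mul1r//; exact: deform_diag.
pose G U := if U \in orthants M then weight M (solution M U) *
    (sqfree (solution M U) S * sqfree (solution M U) T) else 0.
have gG U : g m U @[m --> \oo] --> G U.
  rewrite /G; case: ifPn => UM; last exact: deformed_escape_cvg0.
  apply: cvgM; last by apply: cvgM; apply: cvg_sqfree => k; exact: deformed_coord_cvg.
  apply: cvg_weight => // [i j|k]; last exact: deformed_coord_cvg.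
  rewrite -[X in _ --> X]addr0 -(mul0r ((1%:M - M) i j)).
  under eq_cvg do rewrite !mxE; rewrite !mxE.
  apply: cvgD; first exact: cvg_cst.
  by apply: cvgMl.
have gsumc : \sum_U g m U @[m --> \oo] --> \sum_U G U.
  by apply: cvg_big => //; exact: add_continuous.
rewrite big_mkcond/= -[LHS]/(\sum_U G U).
move: gsumc; under eq_cvg do rewrite gsum; move=> gsumc.
rewrite -(cvg_lim (@Rhausdorff R) gsumc) lim_cst//; exact: Rhausdorff.
Qed.

End Moments.

(** * Sums over inverse eigenvectors as sums over orthants *)
Section OrthantSums.
Variables (R : realType) (n : nat) (M : 'M[R]_n).
Hypothesis Mpsd : psd M.

Lemma solution_bij : set_bij [set` orthants M] [set x | inv_eig M x] (solution M).
Proof.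
have oP U : U \in orthants M -> inv_eig M (solution M U) /\ negset (solution M U) = U.
  by rewrite inE => /asboolP/solutionP.
split=> [U /= /oP[]//|U V|x xV].
  by move=> /set_mem/= /oP[_ UE] /set_mem/= /oP[_ VE] UV; rewrite -UE UV VE.
have xo : negset x \in orthants M by rewrite inE; apply/asboolP; exists x.
exists (negset x) => //; have [sV sx] := oP _ xo.
exact: inv_eig_orthant_unique sx.
Qed.

(** Stated for any set [Q] in bijection with the real inverse eigenvectors, to
    cover both the complex sums and the real sums defining the measure. *)
Lemma fsbig_orthants (V : Type) (idx : V) (op : Monoid.com_law idx)
    (T : choiceType) (h : 'cV[R]_n -> T) (Q : set T) (F : T -> V) :
  set_bij [set x | inv_eig M x] Q h ->
  \big[op/idx]_(x \in Q) F x =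
  \big[op/idx]_(U in orthants M) F (h (solution M U)).
Proof.
move=> hbij.
rewrite (reindex_fsbig _ _ _ _ hbij) (reindex_fsbig _ _ _ _ solution_bij).
rewrite -big_enum [RHS]fsbig_seq ?enum_uniq//.
by apply: eq_fsbigl; apply/seteqP; split => U /=; rewrite mem_enum.
Qed.

End OrthantSums.

(** * Complex inverse eigenvectors are real *)
Section ComplexTransfer.
Variables (R : realType) (n : nat).
Implicit Types (M : 'M[R]_n) (x : 'cV[R]_n).

Lemma complex_mx_inj m p : injective (@complex_mx R m p).
Proof. by apply: map_mx_inj => x y []. Qed.

Lemma complex_mx_inv_eig M x : inv_eig M x <-> inv_eig (complex_mx M) (complex_mx x).
Proof.
have E k : complex_mx x k 0 * (complex_mx M *m complex_mx x) k 0 =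
    (x k 0 * (M *m x) k 0)%:C.
  by rewrite /complex_mx -map_mxM !mxE -rmorphM.
split => xV k; first by rewrite E xV.
by have := xV k; rewrite E => -[].
Qed.

Lemma weight_complex_mx M x :
  weight (complex_mx M) (complex_mx x) = (weight M x)%:C.
Proof.
have DE : D (complex_mx x) = complex_mx (D x).
  by apply/matrixP => i j; rewrite !mxE rmorphMn.
rewrite /weight fmorphV -det_map_mx DE /complex_mx map_mxD map_mx1.
by rewrite !map_mxM.
Qed.

(** Write [a = x + i y].  From [a_k (M a)_k = 1] the imaginary part of
    [(M a)_k] is [- y_k / |a_k|^2], so that every term of
    [y^T M y >= 0] is nonpositive, and zero only if [y_k = 0]. *)
Lemma inv_eig_real M (a : 'cV[R[i]]_n) : psd M -> inv_eig (complex_mx M) a ->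
  exists2 x, inv_eig M x & a = complex_mx x.
Proof.
move=> M0 aV.
pose x : 'cV[R]_n := \col_k complex.Re (a k 0).
pose y : 'cV[R]_n := \col_k complex.Im (a k 0).
have MaE k : (complex_mx M *m a) k 0 = ((M *m x) k 0 +i* (M *m y) k 0).
  rewrite !mxE; apply/eqP; rewrite eq_complex /= !raddf_sum/=; apply/andP; split.
    by apply/eqP/eq_bigr => j _; rewrite !mxE; case: (a j 0) => u v /=; ring.
  by apply/eqP/eq_bigr => j _; rewrite !mxE; case: (a j 0) => u v /=; ring.
have aE k : a k 0 = (x k 0 +i* y k 0) by rewrite !mxE; case: (a k 0).
have q k : y k 0 * (M *m y) k 0 <= 0 /\ (y k 0 * (M *m y) k 0 = 0 -> y k 0 = 0).
  have := aV k; rewrite MaE aE.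
  move: (x k 0) (y k 0) ((M *m x) k 0) ((M *m y) k 0) => u v p r [e1 e2].
  have s0 : 0 < u ^+ 2 + v ^+ 2.
    rewrite lt_neqAle addr_ge0 ?sqr_ge0// andbT eq_sym paddr_eq0 ?sqr_ge0//.
    apply/negP => /andP[]; rewrite !sqrf_eq0 => /eqP u0 /eqP v0.
    by move: e1; rewrite u0 v0 !mul0r subrr => /esym/eqP; rewrite oner_eq0.
  have rE : v * r * (u ^+ 2 + v ^+ 2) = - v ^+ 2.
    transitivity (v * (u * (u * r + v * p) - v * (u * p - v * r))); first by ring.
    by rewrite e1 e2; ring.
  split.
    by rewrite -(pmulr_lle0 _ s0) rE oppr_le0 sqr_ge0.
  by move=> vr; move: rE; rewrite vr mul0r => /eqP; rewrite eq_sym oppr_eq0 sqrf_eq0 => /eqP.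
have y0 k : y k 0 = 0.
  apply: (q k).2.
  have : qform M y = 0.
    apply/le_anti; rewrite M0 andbT qformE; apply: sumr_le0 => j _; exact: (q j).1.
  rewrite qformE => /eqP; rewrite -oppr_eq0 -sumrN => /eqP h.
  apply/eqP; rewrite -oppr_eq0; apply/eqP; move: k isT; apply/psumr_eq0P => // j _.
  by rewrite oppr_ge0; exact: (q j).1.
have ax : a = complex_mx x.
  by apply/matrixP => k j; rewrite (ord1 j) aE y0 [RHS]mxE.
by exists x => //; apply/complex_mx_inv_eig; rewrite -ax.
Qed.

Lemma complex_mx_bij M : psd M ->
  set_bij [set x | inv_eig M x] (inv_eigenvectors (complex_mx M)) (@complex_mx R n 1).
Proof.
move=> M0; split=> [x /= xV|x y _ _|a aV].
- by move=> k; exact: (complex_mx_inv_eig M x).1.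
- exact: complex_mx_inj.
- by have [x xV ->] := inv_eig_real M0 aV; exists x.
Qed.

End ComplexTransfer.

(** * The measure carried by the inverse eigenvectors *)
Section FinitelySupportedMeasure.
Variables (R : realType) (n : nat) (M : 'M[R]_n).
Hypothesis Mpsd : psd M.

Definition atom (i : nat) : borel_cV R n :=
  solution M (nth finset.set0 (enum (orthants M)) i).

(** The absolute value only makes each coefficient manifestly nonnegative; it
    disappears for positive semidefinite [M], by [norm_weight]. *)
Definition atom_measure :=
  msum (fun i => mscale (`|weight M (atom i : 'cV[R]_n)|%:nng)%R
                   (\d_(atom i) : {measure set (borel_cV R n) -> \bar R}))
    #|orthants M|.

HB.instance Definition _ := Measure.on atom_measure.

Lemma sum_atoms (V : Type) (idx : V) (op : Monoid.com_law idx)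
    (F : 'cV[R]_n -> V) :
  \big[op/idx]_(i < #|orthants M|) F (atom i) =
  \big[op/idx]_(U in orthants M) F (solution M U).
Proof. by rewrite -[RHS]big_enum [RHS](big_nth finset.set0) -cardE big_mkord. Qed.

Lemma norm_weight x : `|weight M x| = weight M x.
Proof. by rewrite gtr0_norm// weight_gt0. Qed.

Lemma atom_measureE A :
  atom_measure A = (\sum_(U in orthants M)
    (weight M (solution M U))%:E * \d_(solution M U : borel_cV R n) A)%E.
Proof.
rewrite -(sum_atoms _ (fun x => (weight M x)%:E * \d_(x : borel_cV R n) A)%E).
by apply: eq_bigr => i _; rewrite /mscale -[in RHS]norm_weight.
Qed.

Lemma measurable_continuous_cV (f : 'cV[R]_n -> R) : continuous f ->
  measurable_fun setT (f : borel_cV R n -> R).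
Proof.
move=> fc; apply: (measurability (@RGenOInfty.G R)) => [|_ [_ [r ->] <-]].
  exact: RGenOInfty.measurableE.
rewrite setTI; apply: sub_sigma_algebra.
apply: open_comp => [x _|]; first exact: fc.
exact: interval_open.
Qed.

Lemma ge0_integral_atom_measure (f : borel_cV R n -> R) :
  (forall x, 0 <= f x) -> measurable_fun setT f ->
  (\int[atom_measure]_x (f x)%:E)%E =
  (\sum_(U in orthants M) weight M (solution M U) * f (solution M U))%:E.
Proof.
move=> f0 mf; rewrite ge0_integral_measure_sum//; last 2 first.
  by move=> x _; rewrite lee_fin.
  exact/measurable_EFinP.
rewrite -(sum_atoms _ (fun x => weight M x * f x)) -sumEFin.
apply: eq_bigr => i _.
rewrite ge0_integral_mscale//; last 2 first.
  exact/measurable_EFinP.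
  by move=> x _; rewrite lee_fin.
rewrite integral_dirac//; last exact/measurable_EFinP.
by rewrite diracT mul1e -EFinM -[in RHS]norm_weight.
Qed.

Lemma integral_atom_measure (f : 'cV[R]_n -> R) : continuous f ->
  atom_measure.-integrable setT (fun x : borel_cV R n => (f x)%:E) /\
  (\int[atom_measure]_(x in setT) (f x)%:E)%E =
  (\sum_(U in orthants M) weight M (solution M U) * f (solution M U))%:E.
Proof.
move=> /measurable_continuous_cV mf; split.
  apply/integrableP; split; first exact/measurable_EFinP.
  under eq_integral do rewrite abse_EFin.
  rewrite ge0_integral_atom_measure ?ltry//.
  exact: measurableT_comp.
rewrite integralE.
rewrite (_ : _^\+%E = (fun x => ((f : borel_cV R n -> R)^\+ x)%:E)); last first.
  by apply/funext => x; rewrite funeposE /funrpos EFin_max.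
rewrite (_ : _^\-%E = (fun x => ((f : borel_cV R n -> R)^\- x)%:E)); last first.
  by apply/funext => x; rewrite funenegE /funrneg EFin_max.
rewrite !ge0_integral_atom_measure; [|exact: funrneg_ge0|exact: measurable_funrneg
  |exact: funrpos_ge0|exact: measurable_funrpos].
rewrite -EFinB -sumrB; congr EFin; apply: eq_bigr => U _.
by rewrite -mulrBr -[X in _ * X]/((f^\+ - f^\-) (solution M U)) funrposBneg.
Qed.

End FinitelySupportedMeasure.

(** * Mass, mean and covariance *)
Section FirstMoments.
Variables (R : realType) (n : nat) (M : 'M[R]_n).
Hypotheses (hM : correlation_mx M)
  (hoff : forall k l : 'I_n, k != l -> `|M k l| < 1).

Lemma sum_weight1 : \sum_(U in orthants M) weight M (solution M U) = 1.
Proof.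
have := @real_moments _ _ _ hM hoff finset.set0 finset.set0.
rewrite cards0 eqxx => /(_ isT isT); rewrite mulr1n => h; rewrite -[RHS]h.
by apply: eq_bigr => U _; rewrite sqfree0 !mulr1.
Qed.

Lemma sum_weight_coord k :
  \sum_(U in orthants M) weight M (solution M U) * solution M U k 0 = 0.
Proof.
have := @real_moments _ _ _ hM hoff finset.set0 [set k]%SET.
rewrite cards0 cards1 eq_sym -cards_eq0 cards1 => /(_ isT isT).
rewrite mulr0n => h; rewrite -[RHS]h.
by apply: eq_bigr => U _; rewrite sqfree0 sqfree1 mul1r.
Qed.

Lemma sum_weight_tens k l :
  \sum_(U in orthants M) weight M (solution M U) *
    tens (solution M U) (solution M U) k l = (1%:M : 'M[R]_n) k l.
Proof.
have := @real_moments _ _ _ hM hoff [set k]%SET [set l]%SET.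
rewrite !cards1 (inj_eq set1_inj) mxE => /(_ isT isT) <-.
apply: eq_bigr => U _; rewrite !sqfree1 /tens mxE big_ord1.
by rewrite [X in _ * (_ * X)]mxE.
Qed.

End FirstMoments.

Unset Implicit Arguments.

Theorem theorem2 (R : realType) (n : nat) (hn : (2 <= n)%N) (M : 'M[R]_n)
    (hM : correlation_mx M)
    (hoff : forall k l : 'I_n, k != l -> `|M k l| < 1) :
  [/\ finite_set (inv_eigenvectors (complex_mx M)) /\
      (forall a : 'cV[R[i]]_n, inv_eigenvectors (complex_mx M) a ->
        exists x : 'cV[R]_n, a = complex_mx x),
      forall a : 'cV[R[i]]_n, inv_eigenvectors (complex_mx M) a ->
        0 < weight (complex_mx M) a,
      \sum_(a \in inv_eigenvectors (complex_mx M))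
        weight (complex_mx M) a = 1,
      \sum_(a \in inv_eigenvectors (complex_mx M))
        weight (complex_mx M) a *: tens a a = 1%:M &
      exists P : probability (borel_cV R n) R,
        [/\ forall A : set (borel_cV R n), measurable A -> P A = inv_eig_measure M A,
            centered P & isotropic P] ].
Proof.
have Mpsd : psd M by case: hM.
have fin : finite_set (inv_eigenvectors (complex_mx M)).
  have [_ _ surj] := set_bij_comp (solution_bij Mpsd) (complex_mx_bij Mpsd).
  exact: sub_finite_set surj (finite_image _ finite_finset).
have sumE (V : nmodType) (F : 'cV[R[i]]_n -> V) :
    \sum_(a \in inv_eigenvectors (complex_mx M)) F a =
    \sum_(U in orthants M) F (complex_mx (solution M U)).
  exact: fsbig_orthants (complex_mx_bij Mpsd).
split.
- split=> // a aV; have [x _ ->] := inv_eig_real Mpsd aV; by exists x.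
- move=> a aV; have [x _ ->] := inv_eig_real Mpsd aV.
  by rewrite weight_complex_mx ltcR weight_gt0.
- rewrite sumE; under eq_bigr do rewrite weight_complex_mx.
  by rewrite -rmorph_sum sum_weight1.
- rewrite sumE; apply/matrixP => k l; rewrite summxE.
  transitivity ((1%:M : 'M[R]_n) k l)%:C; last by rewrite !mxE rmorph_nat.
  rewrite -(sum_weight_tens hM hoff) rmorph_sum; apply: eq_bigr => U _.
  by rewrite mxE weight_complex_mx rmorphM /tens /complex_mx map_trmx -map_mxM mxE.
have PT : atom_measure M setT = 1%E.
  rewrite atom_measureE//; under eq_bigr do rewrite diracT mule1.
  by rewrite sumEFin sum_weight1.
pose P : probability (borel_cV R n) R :=
  HB.pack (atom_measure M) (Measure_isProbability.Build _ _ _ (atom_measure M) PT).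
exists P; split.
- move=> A mA; rewrite [LHS]atom_measureE// /inv_eig_measure.
  rewrite (fsbig_orthants Mpsd _ _ (h := id))//.
  split=> [x /= xV|x y _ _ //|x xV].
  + exact: (complex_mx_inv_eig M x).1.
  + by exists x => //; apply/complex_mx_inv_eig.
- move=> k; have := integral_atom_measure Mpsd (@coord_continuous R n 1 k 0).
  by rewrite sum_weight_coord.
- move=> k l.
  have tc : continuous (fun x : 'cV[R]_n => tens x x k l).
    rewrite (_ : (fun _ => _) = (fun x : 'cV[R]_n => x k 0 * x l 0)).
      by move=> x; apply: continuousM; exact: coord_continuous.
    by apply/funext => x; rewrite /tens mxE big_ord1 [X in _ * X]mxE.
  by have := integral_atom_measure Mpsd tc; rewrite sum_weight_tens.
Qed.
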